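(* Let $D$ be a random variable on $\{1,2,\dots\}$ with probability mass function $\boldsymbol p=(p_j)_{j\ge1}$, $\mathbb{E}[D]<\infty$ and $\nu=\mathbb{E}[D(D-1)]/\mathbb{E}[D]>1$. Suppose $\boldsymbol r,\boldsymbol r'\in[0,1]^{\mathbb N}$ satisfy $\boldsymbol r\preccurlyeq_{\boldsymbol p}\boldsymbol r'$. Then $\rho(\boldsymbol r')\le\rho(\boldsymbol r)$ and $e(\boldsymbol r')\le e(\boldsymbol r)$.
   Context: Order: $\boldsymbol r\preccurlyeq_{\boldsymbol p}\boldsymbol r'$ means $\sum_{j\ge K}p_jr_j\le\sum_{j\ge K}p_jr'_j$ for every $K\ge 1$ (the total sums $\mathbb{E}[r_D]$ and $\mathbb{E}[r'_D]$ may differ). For $\boldsymbol r\in[0,1]^{\mathbb N}$, $$\rho(\boldsymbol r)=1-\mathbb{E}[r_D]-\sum_{i\ge1}(1-r_i)p_i\eta_{\boldsymbol r}^i,\qquad e(\boldsymbol r)=\frac{\mathbb{E}[D]}{2}(1-\eta_{\boldsymbol r}^2)-\mathbb{E}[Dr_D](1-\eta_{\boldsymbol r}),$$ where $\eta_{\boldsymbol r}\in[0,1]$ is the smallest solution $\eta\in[0,1]$ of $\sum_{i\ge1}i(1-r_i)p_i\eta^{i-1}+\mathbb{E}[Dr_D]=\mathbb{E}[D]\eta$ (with $0^0=1$). (These are the limiting proportions of vertices and edges in the giant of a configuration model with limiting degree $D$, after removing a proportion $r_i$ of the degree-$i$ vertices for each $i$.) *)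

(* Defs.v *)
From mathcomp Require Import all_boot all_order all_algebra.
From mathcomp Require Import all_classical all_reals all_analysis.

Set Implicit Arguments.
Unset Strict Implicit.
Unset Printing Implicit Defensive.

Import Order.TTheory GRing.Theory Num.Theory.

Local Open Scope classical_set_scope.
Local Open Scope ring_scope.

(* A vector indexed by {1, 2, ...} is encoded as a function on [nat] whose value
   at 0 is irrelevant: every series starts at 1, and D is assumed positive.
   Expectations and series of nonnegative terms live in \bar R, so no convergence
   has to be assumed for them to be meaningful. *)

Section degree_distribution.
Context d (T : measurableType d) (R : realType) (P : probability T R)
  (D : {RV P >-> nat}).

Definition degree_pmf (j : nat) : R := fine (P (D @^-1` [set j])).

Definition mean_degree : \bar R := 'E_P[fun w => (D w)%:R%R].

Definition nu : \bar R :=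
  ('E_P[fun w => ((D w)%:R * ((D w)%:R - 1))%R] / mean_degree)%E.

Implicit Types (r : nat -> R) (x : R).

Definition removed_vertices r : \bar R := 'E_P[fun w => r (D w)].

Definition removed_degree r : \bar R := 'E_P[fun w => ((D w)%:R * r (D w))%R].

Definition eta_equation r x : Prop :=
  (\sum_(1 <= i <oo) (i%:R * (1 - r i) * degree_pmf i * x ^+ i.-1)%:E
   + removed_degree r = mean_degree * x%:E)%E.

Definition eta_solutions r : set R :=
  [set x | 0 <= x <= 1 /\ eta_equation r x].

(* The smallest solution; the default value 0 of [xget] is never used when
   D >= 1, E[D] is finite and r takes values in [0, 1]: both sides of the
   equation divided by E[D] > 0 then exhibit x as a fixed point of a
   nondecreasing self-map of [0, 1], so a least solution exists. *)
Definition eta r : R :=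
  xget 0 [set x | eta_solutions r x /\ forall y, eta_solutions r y -> x <= y].

Definition rho r : \bar R :=
  (1 - removed_vertices r
   - \sum_(1 <= i <oo) ((1 - r i) * degree_pmf i * eta r ^+ i)%:E)%E.

Definition giant_edges r : \bar R :=
  (mean_degree / 2%:E * (1 - eta r ^+ 2)%:E
   - removed_degree r * (1 - eta r)%:E)%E.

End degree_distribution.

Definition tail_dominated (R : realType) (p r r' : nat -> R) : Prop :=
  forall K : nat, (1 <= K)%N ->
    (\sum_(K <= j <oo) (p j * r j)%:E <= \sum_(K <= j <oo) (p j * r' j)%:E)%E.

(* Main.v *)
Require Import Defs.
From mathcomp Require Import all_boot all_order all_algebra.
From mathcomp Require Import all_classical all_reals all_analysis.
From mathcomp Require Import measurable_realfun ring lra.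

(** Write eta for the smallest solution attached to r.  Once the equation that
    defines eta is substituted, both quantities become means over the retained
    vertices of an explicit function of the degree:

      rho(r)  = E[(1 - r_D) (1 - eta^D)],
      2 e(r)  = E[(1 - r_D) D (1 - eta) (1 + eta^(D-1))],

    and the equation itself reads
      E[(1 - r_D) D (1 - eta^(D-1))] = E[D] (1 - eta).

    The three functions of the degree that occur here ([vertex_kernel],
    [edge_kernel] and [excess_kernel]) vanish at degree 0 and are nondecreasing
    in the degree.  By summation by parts, such a function is a nonnegative
    combination of indicators of tails {D >= K}, so its mean over the retained
    vertices decreases when r is replaced by an r' that dominates it on tails
    ([retained_mean_antitone]).

    Applied to [excess_kernel], this shows that the map whose least fixed point
    is eta increases with r.  By Knaster and Tarski the least fixed point is
    also the least point that the map does not increase, so eta <= eta'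
    ([le_eta]).  Finally [vertex_kernel] and [edge_kernel] are nonincreasing in
    eta: replacing first r by r' at fixed eta', and then eta by eta', can only
    decrease rho and e.  *)

Set Implicit Arguments.
Unset Strict Implicit.
Unset Printing Implicit Defensive.

Import Order.TTheory GRing.Theory Num.Theory.

Local Open Scope ring_scope.

(** * Three functions of the degree *)

Section kernels.
Context {R : realType}.
Implicit Types (x y : R) (n i : nat).

Definition excess_kernel x i : R := i%:R * (1 - x ^+ i.-1).
Definition vertex_kernel x i : R := 1 - x ^+ i.
Definition edge_kernel x i : R := i%:R * ((1 - x) * (1 + x ^+ i.-1)).

Lemma expr01 x n : 0 <= x <= 1 -> 0 <= x ^+ n <= 1.
Proof. by move=> /andP[x0 x1]; rewrite exprn_ge0// exprn_ile1. Qed.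

Lemma excess_kernel_bound x i :
  0 <= x <= 1 -> `|excess_kernel x i| <= 1 * i%:R.
Proof.
move=> /(expr01 i.-1)/andP[a b].
rewrite ger0_norm /excess_kernel; last by rewrite mulr_ge0// subr_ge0.
by rewrite mul1r ler_piMr// gerBl.
Qed.

Lemma vertex_kernel_bound x i :
  (1 <= i)%N -> 0 <= x <= 1 -> `|vertex_kernel x i| <= 1 * i%:R.
Proof.
move=> i1 /(expr01 i)/andP[a b]; rewrite ger0_norm /vertex_kernel ?subr_ge0//.
have : 1 <= i%:R :> R by rewrite ler1n.
lra.
Qed.

Lemma edge_kernel_bound x i :
  0 <= x <= 1 -> `|edge_kernel x i| <= 2 * i%:R.
Proof.
move=> x01; have /andP[a b] := expr01 i.-1 x01.
move: x01 => /andP[x0 x1]; rewrite /edge_kernel ger0_norm; last first.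
  by rewrite mulr_ge0// mulr_ge0; lra.
rewrite mulrC ler_wpM2r//; nra.
Qed.

Lemma excess_kernel_nondecreasing x i :
  0 <= x <= 1 -> excess_kernel x i <= excess_kernel x i.+1.
Proof.
move=> x01; have /andP[a b] := expr01 i x01.
move: x01 => /andP[x0 x1]; rewrite /excess_kernel /=.
case: i => [|i] in a b *; first by rewrite mul0r expr0 subrr mulr0.
apply: ler_pM => //; first by rewrite subr_ge0 exprn_ile1.
  by rewrite ler_nat.
by rewrite lerD2l lerN2 exprS ler_piMl// exprn_ge0.
Qed.

Lemma vertex_kernel_nondecreasing x i :
  0 <= x <= 1 -> vertex_kernel x i <= vertex_kernel x i.+1.
Proof.
move=> /andP[x0 x1]; rewrite lerD2l lerN2 exprS.
by rewrite ler_piMl// exprn_ge0.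
Qed.

(** 1 - x^n is (1 - x) times a sum of n powers of x, each at least x^(n-1). *)
Lemma mean_power_bound x n :
  0 <= x <= 1 -> n%:R * x ^+ n.-1 * (1 - x) <= 1 - x ^+ n.
Proof.
move=> /andP[x0 x1]; case: n => [|n]; first by rewrite expr0 !mul0r subrr.
elim: n => [|n IH]; first by rewrite /= expr0 expr1; lra.
move: IH; rewrite /= !exprS [n.+2%:R]mulrS.
have : 0 <= x ^+ n <= 1 by apply: expr01; rewrite x0.
move: (x ^+ n) (n.+1%:R) => y c /andP[y0 y1] IH.
have h1 : x * (c * y * (1 - x)) <= x * (1 - x * y) by rewrite ler_wpM2l.
have h2 : x * y <= 1 by nra.
have h3 : 0 <= (1 - x) * (1 - x * y) by rewrite mulr_ge0; lra.
nra.
Qed.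

(** Up to the factor 1 - x, the increment from i to i + 1 is
    1 + x^i - i x^(i-1) (1 - x), and the last term is at most 1 - x^i, which
    leaves at least 2 x^i. *)
Lemma edge_kernel_nondecreasing x i :
  0 <= x <= 1 -> edge_kernel x i <= edge_kernel x i.+1.
Proof.
move=> x01; have := mean_power_bound i x01.
have /andP[a b] := expr01 i x01.
move: x01 => /andP[x0 x1] h; rewrite /edge_kernel /=.
rewrite mulrCA [leRHS]mulrCA ler_wpM2l ?subr_ge0//.
case: i => [|i] in a b h *; first by rewrite expr0; lra.
move: h a b; rewrite /= exprS [i.+2%:R]mulrS.
move: (x ^+ i) (i.+1%:R) => y c h h1 h2.
nra.
Qed.

(** Convexity of t |-> t^n: the chord over [x, y] is no steeper than the chord
    over [x, 1]. *)
Lemma expr_chord x y n : 0 <= x -> x <= y -> y <= 1 ->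
  (1 - x) * (y ^+ n - x ^+ n) <= (y - x) * (1 - x ^+ n).
Proof.
move=> x0 xy y1; elim: n => [|n IH]; first by rewrite !expr0; lra.
have : 0 <= x ^+ n <= 1 by apply: expr01; lra.
rewrite !exprS; move: (x ^+ n) (y ^+ n) IH => a b IH /andP[a0 a1].
have h1 : y * ((1 - x) * (b - a)) <= y * ((y - x) * (1 - a)).
  by rewrite ler_wpM2l//; lra.
have h2 : y * ((y - x) * (1 - a)) <= (y - x) * (1 - a).
  by rewrite ler_piMl// mulr_ge0; lra.
nra.
Qed.

Lemma vertex_kernel_nonincreasing x y i : 0 <= x -> x <= y ->
  vertex_kernel y i <= vertex_kernel x i.
Proof. by move=> x0 xy; rewrite lerD2l lerN2 lerXn2r// nnegrE; lra. Qed.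

(** (1 - x)(1 + x^n) has derivative -1 + n x^(n-1) - (n+1) x^n, whose sign is
    not obvious; the chord inequality bounds the growth of x^n (1 - x) by the
    decrease of 1 - x instead. *)
Lemma edge_kernel_nonincreasing x y i : 0 <= x -> x <= y -> y <= 1 ->
  edge_kernel y i <= edge_kernel x i.
Proof.
move=> x0 xy y1; rewrite ler_wpM2l//.
have := expr_chord i.-1 x0 xy y1.
have : 0 <= y ^+ i.-1 by rewrite exprn_ge0//; lra.
have : 0 <= x ^+ i.-1 by rewrite exprn_ge0//; lra.
move: (x ^+ _) (y ^+ _) => a b a0 b0 h.
nra.
Qed.

End kernels.

(** * Summation by tails *)

Section tail_summation.
Context {R : realType}.
Local Open Scope ereal_scope.

(** Summation by parts for nonnegative series: each a_i is telescoped into its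
    increments a_(k+1) - a_k with k < i, and the two sums are exchanged. *)
Lemma sum_by_tails (u a : nat -> R) : (forall i, (1 <= i)%N -> (0 <= u i)%R) ->
  a 0%N = 0%R -> (forall i, (a i <= a i.+1)%R) ->
  \sum_(1 <= i <oo) (u i * a i)%:E =
  \sum_(0 <= k <oo) ((a k.+1 - a k)%:E * \sum_(k.+1 <= i <oo) (u i)%:E).
Proof.
move=> u0 a0 a_incr.
pose f i k : \bar R := if (k < i)%N then (u i * (a k.+1 - a k))%:E else 0.
have f0 i k : 0 <= f i k.
  rewrite /f; case: ifPn => // ki; rewrite lee_fin mulr_ge0 ?subr_ge0//.
  by rewrite u0//; case: i ki.
have rowE i : \sum_(0 <= k <oo) f i k = (u i * a i)%:E.
  rewrite (nneseries_split 0 i)// add0n [X in _ + X]eseries0; last first.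
    by move=> k ik _; rewrite /f ltnNge ik.
  rewrite adde0 big_nat_cond.
  under eq_bigr => k /andP[/andP[_ ki] _] do rewrite /f ki.
  rewrite -big_nat_cond sumEFin -mulr_sumr telescope_sumr//.
  by rewrite a0 subr0.
transitivity (\sum_(0 <= i <oo) \sum_(0 <= k <oo) f i k).
  rewrite [LHS]eseries_cond [LHS]eseries_mkcond; apply: eq_eseriesr => i _.
  by rewrite rowE; case: i => //=; rewrite a0 mulr0.
rewrite (nneseries_interchange xpredT xpredT)//.
apply: eq_eseriesr => k _.
rewrite [in RHS]eseries_cond [in RHS]eseries_mkcond.
rewrite -nneseriesZl; last first.
  by move=> i _; case: ifPn => // ki; rewrite lee_fin u0//; case: i ki.
apply: eq_eseriesr => i _; rewrite /f /=.
by case: ifP; rewrite ?mule0// -EFinM mulrC.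
Qed.

Lemma le_sum_tails (u v a : nat -> R) :
  (forall i, (1 <= i)%N -> (0 <= u i)%R) ->
  (forall i, (1 <= i)%N -> (0 <= v i)%R) ->
  a 0%N = 0%R -> (forall i, (a i <= a i.+1)%R) ->
  (forall K, (1 <= K)%N ->
    \sum_(K <= i <oo) (u i)%:E <= \sum_(K <= i <oo) (v i)%:E) ->
  \sum_(1 <= i <oo) (u i * a i)%:E <= \sum_(1 <= i <oo) (v i * a i)%:E.
Proof.
move=> u0 v0 a0 a_incr uv; rewrite !sum_by_tails//.
apply: lee_nneseries => [k _ _|k _].
  rewrite mule_ge0// ?lee_fin ?subr_ge0//.
  by apply: nneseries_ge0 => i ki _; rewrite lee_fin u0//; case: i ki.
by rewrite lee_wpmul2l// ?lee_fin ?subr_ge0// uv.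
Qed.

End tail_summation.

(** * Least fixed points *)

(** The Knaster-Tarski argument: the infimum of the points x with g x <= x is a
    fixed point.  The minimality obtained here, among all those points rather
    than among fixed points only, is what allows the fixed points of two
    different maps to be compared. *)
Lemma least_prefixpoint {R : realType} (g : R -> R) :
  (forall x, 0 <= x <= 1 -> 0 <= g x <= 1) ->
  (forall x y, 0 <= x -> x <= y -> y <= 1 -> g x <= g y) ->
  exists x, [/\ 0 <= x <= 1, g x = x
    & forall y, 0 <= y <= 1 -> g y <= y -> x <= y].
Proof.
move=> g01 g_incr.
pose A := [set x | 0 <= x <= 1 /\ g x <= x]%classic.
have A1 : A 1 by split; [lra | have /andP[] := g01 1 ltac:(lra)].
have Alb : has_lbound A by exists 0 => x [/andP[]].
have leA y : A y -> inf A <= y by apply: ge_inf.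
have i0 : 0 <= inf A by apply: lb_le_inf; [exists 1 | move=> x [/andP[]]].
have i1 : inf A <= 1 by exact: leA.
have i01 : 0 <= inf A <= 1 by rewrite i0.
have gi : g (inf A) <= inf A.
  apply: lb_le_inf; first by exists 1.
  move=> y Ay; have [/andP[y0 y1] gy] := Ay.
  by apply: le_trans gy; apply: g_incr => //; exact: leA.
exists (inf A); split => //; last by move=> y y01 gy; apply: leA.
apply/eqP; rewrite eq_le gi leA//; split; first exact: g01.
by apply: g_incr => //; have /andP[] := g01 _ i01.
Qed.

(** * Means of functions of the degree *)

Section degree_means.
Context d (T : measurableType d) (R : realType) (P : probability T R)
  (D : {RV P >-> nat}).
Context (D_pos : forall w : T, (1 <= D w)%N)
  (D_mean : (mean_degree D < +oo)%E).
Implicit Types (h : nat -> R) (r : nat -> R) (x : R).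

Local Notation p := (degree_pmf D).

Definition degree_fun_mean h : R := (\int[P]_w h (D w))%R.
Local Notation E := degree_fun_mean.

(** Linear growth is the integrability criterion that D with E[D] finite
    provides.  It is imposed from degree 1 on, because the value at 0 of r is
    arbitrary. *)
Definition linear_growth h : Prop :=
  exists C, forall i, (1 <= i)%N -> `|h i| <= C * i%:R.

Lemma measurable_degree_fun h : measurable_fun setT (h \o D).
Proof. exact: measurableT_comp. Qed.

Lemma degree_fun_integrable h :
  linear_growth h -> P.-integrable setT (EFin \o (h \o D)).
Proof.
move=> [C hC].
have intD : P.-integrable setT (EFin \o ((fun i => i%:R) \o D)).
  apply/integrableP; split.
    by apply/measurable_EFinP; exact: measurable_degree_fun.
  move: D_mean; rewrite /mean_degree unlock; congr (_ < _)%E.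
  by apply: eq_integral => w _ /=; rewrite normr_nat.
apply: (le_integrable measurableT _ _ (integrableZl measurableT C intD)).
  by apply/measurable_EFinP; exact: measurable_degree_fun.
move=> w _ /=; rewrite lee_fin; apply: le_trans (hC _ (D_pos w)) _.
exact: ler_norm.
Qed.

Lemma eq_degree_fun_mean h h' :
  (forall i, (1 <= i)%N -> h i = h' i) -> E h = E h'.
Proof. by move=> hh; apply: eq_Rintegral => w _; rewrite hh. Qed.

Lemma le_degree_fun_mean h h' : linear_growth h -> linear_growth h' ->
  (forall i, (1 <= i)%N -> h i <= h' i) -> E h <= E h'.
Proof.
move=> gh gh' hh; apply: le_Rintegral => //; try exact: degree_fun_integrable.
by move=> w _; exact: hh.
Qed.

Lemma linear_growthD h h' : linear_growth h -> linear_growth h' ->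
  linear_growth (fun i => h i + h' i).
Proof.
move=> [C hC] [C' hC']; exists (C + C') => i i1; rewrite mulrDl.
by apply: le_trans (ler_normD _ _) _; rewrite lerD ?hC ?hC'.
Qed.

Lemma linear_growthZ c h : linear_growth h -> linear_growth (fun i => c * h i).
Proof.
move=> [C hC]; exists (`|c| * C) => i i1; rewrite normrM -mulrA.
by rewrite ler_wpM2l ?hC.
Qed.

Lemma degree_fun_meanD h h' : linear_growth h -> linear_growth h' ->
  E (fun i => h i + h' i) = E h + E h'.
Proof.
move=> gh gh'; rewrite /degree_fun_mean -RintegralD//;
  exact: degree_fun_integrable.
Qed.

Lemma degree_fun_meanZ c h : linear_growth h ->
  E (fun i => c * h i) = c * E h.
Proof.
move=> gh; rewrite /degree_fun_mean -RintegralZl//.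
exact: degree_fun_integrable.
Qed.

Lemma degree_fun_meanE h : linear_growth h -> ('E_P[h \o D] = (E h)%:E)%E.
Proof.
move=> gh; rewrite unlock /degree_fun_mean /Rintegral fineK//.
by apply: integrable_fin_num => //; exact: degree_fun_integrable.
Qed.

Lemma degree_pmf_ge0 i : 0 <= p i.
Proof. exact: fine_ge0. Qed.

(** The law of the unconscious statistician, by splitting the probability space
    along the fibers of D; the fiber over 0 is empty, hence a series starting
    at 1. *)
Lemma degree_fun_mean_series h : linear_growth h ->
  (forall i, (1 <= i)%N -> 0 <= h i) ->
  (\sum_(1 <= i <oo) (h i * p i)%:E)%E = (E h)%:E.
Proof.
move=> gh h0; rewrite -degree_fun_meanE// expectation.unlock.
pose F k : set T := (D @^-1` [set k])%classic.
have mF k : measurable (F k) by exact: measurable_funPTI.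
have UF : (\bigcup_k F k = setT)%classic.
  by apply/seteqP; split => // w _; exists (D w).
rewrite -UF ge0_integral_bigcup//; last 3 first.
- apply/measurable_EFinP; apply: measurable_funTS.
  exact: measurable_degree_fun.
- by move=> w _ /=; rewrite lee_fin h0.
- apply/trivIsetP => i j _ _ /eqP ij; apply/seteqP; split => // w [/= Di Dj].
  by apply: ij; rewrite -Di -Dj.
rewrite [LHS]eseries_cond [LHS]eseries_mkcond; apply: eq_eseriesr => i _.
rewrite (eq_integral (cst (h i)%:E)); last by move=> w /set_mem /= <-.
rewrite integral_cst//; case: i => [|i] /=.
  rewrite (_ : F 0%N = set0) ?measure0 ?mule0//.
  by apply/seteqP; split => // w /= w0; have := D_pos w; rewrite w0.
by rewrite EFinM /degree_pmf fineK//; apply: fin_num_measure; exact: mF.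
Qed.


Lemma linear_growth_natr : linear_growth (fun i => i%:R).
Proof. by exists 1 => i _; rewrite normr_nat mul1r. Qed.

Lemma linear_growth_cst c : linear_growth (fun=> c).
Proof. by exists `|c| => i i1; rewrite ler_peMr// ler1n. Qed.

Lemma linear_growthM01 g h : (forall i, (1 <= i)%N -> 0 <= g i <= 1) ->
  linear_growth h -> linear_growth (fun i => g i * h i).
Proof.
move=> g01 [C hC]; exists C => i i1; have /andP[g0 g1] := g01 i i1.
by rewrite normrM ger0_norm//; apply: le_trans (hC i i1); rewrite ler_piMl.
Qed.

(** * Means over the retained vertices *)

Definition unit_valued r : Prop := forall i, (1 <= i)%N -> 0 <= r i <= 1.

Lemma linear_growth_unit_valued g : unit_valued g -> linear_growth g.
Proof.
move=> g01; exists 1 => i i1; have /andP[g0 g1] := g01 i i1.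
by rewrite ger0_norm// mul1r (le_trans g1)// ler1n.
Qed.

Lemma unit_valued_retained r : unit_valued r -> unit_valued (fun i => 1 - r i).
Proof. by move=> r01 i /r01; lra. Qed.

Definition retained_mean r h : R := E (fun i => (1 - r i) * h i).
Local Notation mu := (E (fun i => i%:R)).

Lemma retained_meanE r h : unit_valued r -> linear_growth h ->
  retained_mean r h = E h - E (fun i => r i * h i).
Proof.
move=> r01 gh; rewrite -mulN1r -degree_fun_meanZ; last exact: linear_growthM01.
rewrite -degree_fun_meanD//; last exact/linear_growthZ/linear_growthM01.
by apply: eq_degree_fun_mean => i _; ring.
Qed.

Lemma le_retained_mean r h h' : unit_valued r ->
  linear_growth h -> linear_growth h' ->
  (forall i, (1 <= i)%N -> h i <= h' i) ->
  retained_mean r h <= retained_mean r h'.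
Proof.
move=> r01 gh gh' hh'; have q01 := unit_valued_retained r01.
apply: le_degree_fun_mean => [||i i1]; try exact: linear_growthM01.
by rewrite ler_wpM2l ?hh'//; have /andP[] := q01 i i1.
Qed.

(** Removing more mass from the tails lowers the retained mean of every
    nondecreasing function of the degree.  The total removed masses of r and r'
    may differ, which is why h must also be nonnegative; this is enforced by
    h 0 = 0. *)
Lemma retained_mean_antitone r r' h : unit_valued r -> unit_valued r' ->
  tail_dominated p r r' ->
  linear_growth h -> h 0%N = 0 -> (forall i, h i <= h i.+1) ->
  retained_mean r' h <= retained_mean r h.
Proof.
move=> r01 r'01 rr' gh h0 h_incr.
have h_ge0 i : 0 <= h i.
  by elim: i => [|i IH]; [rewrite h0 | exact: le_trans IH _].
rewrite !retained_meanE// lerD2l lerN2 -lee_fin.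
have mean_removed q : unit_valued q -> (E (fun i => q i * h i))%:E
    = (\sum_(1 <= i <oo) (p i * q i * h i)%:E)%E.
  move=> q01; rewrite -degree_fun_mean_series; last 2 first.
  - exact: linear_growthM01.
  - by move=> i /q01 /andP[q0 _]; rewrite mulr_ge0.
  by apply: eq_eseriesr => i _; congr (_%:E); ring.
rewrite !mean_removed//; apply: le_sum_tails => // i i1.
  by have /andP[? _] := r01 i i1; rewrite mulr_ge0 ?degree_pmf_ge0.
by have /andP[? _] := r'01 i i1; rewrite mulr_ge0 ?degree_pmf_ge0.
Qed.

Lemma mean_degreeE : mean_degree D = mu%:E.
Proof. exact: (degree_fun_meanE linear_growth_natr). Qed.

Lemma removed_verticesE r : unit_valued r -> removed_vertices D r = (E r)%:E.
Proof.
by move=> r01; apply/degree_fun_meanE/linear_growth_unit_valued.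
Qed.

Lemma linear_growth_degree_mul g : unit_valued g ->
  linear_growth (fun i => i%:R * g i).
Proof.
move=> g01; have [C hC] := linear_growthM01 g01 linear_growth_natr.
by exists C => i i1; rewrite mulrC hC.
Qed.

Lemma removed_degreeE r : unit_valued r ->
  removed_degree D r = (E (fun i => i%:R * r i))%:E.
Proof. by move=> r01; apply/degree_fun_meanE/linear_growth_degree_mul. Qed.

Lemma unit_valued_power r x m : unit_valued r -> 0 <= x <= 1 ->
  unit_valued (fun i => (1 - r i) * x ^+ m i).
Proof.
move=> r01 x01 i i1; have /andP[? ?] := unit_valued_retained r01 i1.
have /andP[? ?] := expr01 (m i) x01.
by rewrite mulr_ge0//= mulr_ile1.
Qed.

(** * The smallest solution eta *)

(** The left-hand side of the equation defining eta, whose right-hand side is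
    E[D] x. *)
Definition eta_fun r x : R :=
  E (fun i => i%:R * ((1 - r i) * x ^+ i.-1)) + E (fun i => i%:R * r i).

Lemma eta_equationE r x : unit_valued r -> 0 <= x <= 1 ->
  eta_equation D r x <-> eta_fun r x = mu * x.
Proof.
move=> r01 x01; rewrite /eta_equation mean_degreeE removed_degreeE//.
have -> : (\sum_(1 <= i <oo) (i%:R * (1 - r i) * p i * x ^+ i.-1)%:E)%E =
    (E (fun i => i%:R * ((1 - r i) * x ^+ i.-1)))%:E.
  have q01 := unit_valued_power (fun i => i.-1) r01 x01.
  rewrite -degree_fun_mean_series; last 2 first.
  - exact: linear_growth_degree_mul.
  - by move=> i /q01 /andP[q0 _]; rewrite mulr_ge0.
  by apply: eq_eseriesr => i _; congr (_%:E); ring.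
by rewrite -EFinD -EFinM -/(eta_fun r x); split=> [[]|->].
Qed.

Lemma linear_growth_excess x : 0 <= x <= 1 -> linear_growth (excess_kernel x).
Proof. by move=> x01; exists 1 => i _; exact: excess_kernel_bound. Qed.

Lemma linear_growth_vertex x : 0 <= x <= 1 -> linear_growth (vertex_kernel x).
Proof. by move=> x01; exists 1 => i i1; exact: vertex_kernel_bound. Qed.

Lemma linear_growth_edge x : 0 <= x <= 1 -> linear_growth (edge_kernel x).
Proof. by move=> x01; exists 2 => i _; exact: edge_kernel_bound. Qed.

(** The form of the left-hand side to which [retained_mean_antitone] and the
    monotonicity in x apply: E[D r_D] is E[D] minus the retained half-edges. *)
Lemma eta_fun_excess r x : unit_valued r -> 0 <= x <= 1 ->
  eta_fun r x = mu - retained_mean r (excess_kernel x).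
Proof.
move=> r01 x01; rewrite /eta_fun.
have g1 := linear_growth_degree_mul (unit_valued_power predn r01 x01).
have g2 := linear_growth_degree_mul r01.
have g3 : linear_growth (fun i => (1 - r i) * excess_kernel x i).
  by apply: linear_growthM01; [exact: unit_valued_retained
                              |exact: linear_growth_excess].
rewrite -degree_fun_meanD//; apply/eqP; rewrite -subr_eq opprK; apply/eqP.
rewrite -degree_fun_meanD//; last exact: linear_growthD.
by apply: eq_degree_fun_mean => i _; rewrite /excess_kernel; ring.
Qed.

Lemma mean_one : E (fun=> 1) = 1.
Proof.
rewrite /degree_fun_mean (Rintegral_cst P measurableT) mul1r.
exact: (congr1 fine (probability_setT P)).
Qed.

Lemma mean_degree_gt0 : 0 < mu.
Proof.
apply: lt_le_trans ltr01 _.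
rewrite -[leLHS]mean_one.
apply: le_degree_fun_mean => [||i i1]; last by rewrite ler1n.
  exact: linear_growth_cst.
exact: linear_growth_natr.
Qed.

Lemma eta_fun_nondecreasing r x y : unit_valued r -> 0 <= x -> x <= y ->
  y <= 1 -> eta_fun r x <= eta_fun r y.
Proof.
move=> r01 x0 xy y1; have x01 : 0 <= x <= 1 by lra.
have y01 : 0 <= y <= 1 by lra.
rewrite !eta_fun_excess// lerD2l lerN2.
apply: le_retained_mean => // [||i _]; try exact: linear_growth_excess.
by rewrite ler_wpM2l// lerD2l lerN2 lerXn2r// nnegrE; lra.
Qed.

Lemma eta_fun_itv r x : unit_valued r -> 0 <= x <= 1 -> 0 <= eta_fun r x <= mu.
Proof.
move=> r01 x01; apply/andP; split.
  have q01 := unit_valued_power predn r01 x01.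
  by apply: addr_ge0; apply: Rintegral_ge0 => w _; rewrite mulr_ge0//;
    [have /andP[] := q01 _ (D_pos w)|have /andP[] := r01 _ (D_pos w)].
rewrite eta_fun_excess// gerBl; apply: Rintegral_ge0 => w _.
have /andP[? _] := unit_valued_retained r01 (D_pos w).
have /andP[? ?] := expr01 (D w).-1 x01.
by rewrite !mulr_ge0// subr_ge0.
Qed.

(** [xget] in the definition of eta picks an actual least solution, and this
    solution lies below every x at which the left-hand side is at most
    E[D] x. *)
Lemma etaP r : unit_valued r ->
  [/\ 0 <= eta D r <= 1, eta_fun r (eta D r) = mu * eta D r
    & forall y, 0 <= y <= 1 -> eta_fun r y <= mu * y -> eta D r <= y].
Proof.
move=> r01; have mu0 := mean_degree_gt0.
have [|x y x0 xy y1|x [x01 xE x_least]] :=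
    @least_prefixpoint R (fun x => eta_fun r x / mu).
- move=> x x01; have /andP[? ?] := eta_fun_itv r01 x01.
  by rewrite divr_ge0 ?(ltW mu0)//= ler_pdivrMr// mul1r.
- by rewrite ler_pM2r ?invr_gt0// eta_fun_nondecreasing.
have xsol : eta_solutions D r x.
  split=> //; apply/eta_equationE => //.
  by rewrite -[in RHS]xE mulrCA divff ?mulr1// gt_eqF.
have : (exists x, eta_solutions D r x /\
    forall y, eta_solutions D r y -> x <= y).
  exists x; split=> // y [y01 /eta_equationE-/(_ r01 y01) yE].
  by apply: x_least => //; rewrite yE mulrAC divff ?mul1r// gt_eqF.
move=> /(xgetPex 0); rewrite -/(eta D r) => -[[e01 eE] e_least].
split=> // [|y y01 yE]; first exact/eta_equationE.
apply: le_trans (e_least _ xsol) _; apply: x_least => //.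
by rewrite ler_pdivrMr// mulrC.
Qed.

(** At eta', the left-hand side for r is at most the one for r', which equals
    E[D] eta'; minimality of eta concludes. *)
Lemma le_eta r r' : unit_valued r -> unit_valued r' ->
  tail_dominated p r r' -> eta D r <= eta D r'.
Proof.
move=> r01 r'01 rr'; have [_ _ e_least] := etaP r01.
have [e01 eE _] := etaP r'01; apply: e_least => //.
rewrite -eE !eta_fun_excess// lerD2l lerN2.
apply: retained_mean_antitone => // [||i]; first exact: linear_growth_excess.
  by rewrite /excess_kernel mul0r.
exact: excess_kernel_nondecreasing.
Qed.

(** * The giant as a mean over the retained vertices *)

Lemma rhoE r : unit_valued r ->
  rho D r = (retained_mean r (vertex_kernel (eta D r)))%:E.
Proof.
move=> r01; have [e01 _ _] := etaP r01.
rewrite /rho removed_verticesE//.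
have q01 := unit_valued_power id r01 e01.
have -> : (\sum_(1 <= i <oo) ((1 - r i) * p i * eta D r ^+ i)%:E)%E =
    (E (fun i => (1 - r i) * eta D r ^+ i))%:E.
  rewrite -degree_fun_mean_series; last 2 first.
  - exact: linear_growth_unit_valued.
  - by move=> i /q01 /andP[].
  by apply: eq_eseriesr => i _; congr (_%:E); ring.
have g1 := linear_growth_unit_valued r01.
have g2 := linear_growth_unit_valued q01.
have g3 := linear_growth_vertex e01.
have g4 : linear_growth (fun i => (1 - r i) * vertex_kernel (eta D r) i).
  by apply: linear_growthM01 => //; exact: unit_valued_retained.
rewrite -EFinB; congr (_%:E); apply/eqP; rewrite !subr_eq -addrA; apply/eqP.
rewrite -degree_fun_meanD// -degree_fun_meanD//; last exact: linear_growthD.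
rewrite -[LHS]mean_one; apply: eq_degree_fun_mean => i _.
by rewrite /vertex_kernel; ring.
Qed.

(** The equation for eta enters here: it turns the negative coefficient of
    E[D r_D] in the definition into a mean of a nonnegative function over the
    retained vertices, to which domination applies. *)
Lemma giant_edgesE r : unit_valued r ->
  giant_edges D r = (retained_mean r (edge_kernel (eta D r)) / 2)%:E.
Proof.
move=> r01; have [e01 eE _] := etaP r01; move: e01 eE.
rewrite /giant_edges mean_degreeE removed_degreeE//.
move: (eta D r) => x x01 xE.
have g1 := linear_growth_degree_mul (unit_valued_power predn r01 x01).
have g2 := linear_growth_degree_mul r01.
have -> : retained_mean r (edge_kernel x) = (1 - x) *
  (mu - E (fun i => i%:R * r i) + E (fun i => i%:R * ((1 - r i) * x ^+ i.-1))).
  have g3 := linear_growthZ (-1) g2.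
  have g4 := linear_growthD linear_growth_natr g3.
  rewrite -[- E _]mulN1r -degree_fun_meanZ// -degree_fun_meanD//; last first.
    exact: linear_growth_natr.
  rewrite -degree_fun_meanD// -degree_fun_meanZ; last exact: linear_growthD.
  by apply: eq_degree_fun_mean => i _; rewrite /edge_kernel; ring.
move: xE; rewrite /eta_fun.
move: (E _) (E _) (E _) => m s a xE.
rewrite inver pnatr_eq0 /= -!EFinM -EFinB; congr (_%:E).
(* the equation for eta, solved for the mean of D (1 - r_D) eta^(D-1) *)
have -> : a = m * x - s by lra.
by field.
Qed.

End degree_means.

Theorem corollary1p4 (d : measure_display) (T : measurableType d)
  (R : realType) (P : probability T R) (D : {RV P >-> nat})
  (D_pos : forall w : T, (1 <= D w)%N)
  (D_mean : (mean_degree D < +oo)%E)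
  (D_nu : (1 < nu D)%E)
  (r r' : nat -> R)
  (r01 : forall i : nat, (1 <= i)%N -> 0 <= r i <= 1)
  (r'01 : forall i : nat, (1 <= i)%N -> 0 <= r' i <= 1)
  (rr' : tail_dominated (degree_pmf D) r r') :
  (rho D r' <= rho D r)%E /\ (giant_edges D r' <= giant_edges D r)%E.
Proof.
have [/andP[e0 e1] _ _] := etaP D_pos D_mean r01.
have [/andP[e'0 e'1] _ _] := etaP D_pos D_mean r'01.
have ee' := le_eta D_pos D_mean r01 r'01 rr'.
rewrite !rhoE// !giant_edgesE// !lee_fin; split.
  (* the intermediate term has the removal r but the root eta of r' *)
  apply: (@le_trans _ _ (retained_mean D r (vertex_kernel (eta D r')))).
    apply: retained_mean_antitone => // [||i].
    - by apply: linear_growth_vertex; rewrite e'0.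
    - by rewrite /vertex_kernel expr0 subrr.
    - by apply: vertex_kernel_nondecreasing; rewrite e'0.
  apply: le_retained_mean => // [||i _].
  - by apply: linear_growth_vertex; rewrite e'0.
  - by apply: linear_growth_vertex; rewrite e0.
  - exact: vertex_kernel_nonincreasing.
rewrite ler_pM2r ?invr_gt0//.
apply: (@le_trans _ _ (retained_mean D r (edge_kernel (eta D r')))).
  apply: retained_mean_antitone => // [||i].
  - by apply: linear_growth_edge; rewrite e'0.
  - by rewrite /edge_kernel mul0r.
  - by apply: edge_kernel_nondecreasing; rewrite e'0.
apply: le_retained_mean => // [||i _].
- by apply: linear_growth_edge; rewrite e'0.
- by apply: linear_growth_edge; rewrite e0.
- exact: edge_kernel_nonincreasing.
Qed.
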